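(* Let $c \in \mathbb{R}^n$, let $Q$ be a real symmetric $n \times n$ matrix, and let $\sigma > 0$. Let $k$ be the number of distinct negative eigenvalues of $Q$. Then there exist at most $2(k+1)$ points $s \in \mathbb{R}^n$ with pairwise distinct values of $\lambda$ satisfying $$c + Q s + \lambda s = 0, \qquad \lambda = \sigma \|s\|;$$ that is, the set of all $\lambda \in \mathbb{R}$ for which some $s \in \mathbb{R}^n$ satisfies these two equations has at most $2(k+1)$ elements.
   Context: $\|\cdot\|$ is the Euclidean norm. The two displayed equations are the stationarity conditions of the function $m(s) = c^T s + \frac12 s^T Q s + \frac13 \sigma \|s\|^3$ on $\mathbb{R}^n$. *)

(* Defs.v *)
From mathcomp Require Import all_boot all_order all_algebra.
From mathcomp Require Import reals.

Set Implicit Arguments.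
Unset Strict Implicit.
Unset Printing Implicit Defensive.

Import GRing.Theory Num.Theory.

Local Open Scope ring_scope.

(* MathComp-Analysis norms matrices by the sup norm, hence this definition. *)
Definition enorm (R : realType) (n : nat) (s : 'cV[R]_n) : R :=
  Num.sqrt (\sum_(i < n) s i ord0 ^+ 2).

(* Main.v *)
(* In an orthonormal eigenbasis of Q, a solution s for lambda has coordinates of
   modulus |c_i| / |m_i + lambda|.  Between two consecutive poles - m_i
   (those with c_i <> 0) each of these is strictly convex in lambda, hence so
   is norm s, and it meets the line lambda / sigma at most twice.  The negative
   eigenvalues that give no pole each allow one further solution
   lambda = - m_i, where s is not determined by lambda.  With k' poles this
   makes at most 2 (k' + 1) + (k - k') <= 2 (k + 1) values. *)

Require Import Defs.
From mathcomp Require Import all_boot all_order all_algebra.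
From mathcomp Require Import complex finmap.
From mathcomp Require Import boolp classical_sets cardinality reals.
From mathcomp Require Import ring lra zify.

Set Implicit Arguments.
Unset Strict Implicit.
Unset Printing Implicit Defensive.

Import Order.TTheory GRing.Theory Num.Theory.

Local Open Scope classical_set_scope.
Local Open Scope card_scope.
Local Open Scope ring_scope.

(* T s i is the modulus of the i-th coordinate of s in a unitary eigenbasis of
   the complexification of Q. *)
Lemma symmetric_spectral (R : rcfType) (n : nat) (Q : 'M[R]_n) : Q^T = Q ->
  exists (m : 'I_n -> R) (T : 'cV[R]_n -> 'I_n -> R),
  [/\ forall i, eigenvalue Q (m i),
      forall s i, 0 <= T s i,
      forall s, \sum_i T s i ^+ 2 = \sum_i s i ord0 ^+ 2
    & forall (c s : 'cV[R]_n) a, c + Q *m s + a *: s = 0 ->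
        forall i, `|m i + a| * T s i = T c i].
Proof.
move=> Qs.
pose Qc := map_mx (real_complex R) Q.
have conjR (x : R) : (real_complex R x)^* = real_complex R x.
  by apply/conj_Creal/complex_realP; exists x.
have Qherm : Qc \is hermsymmx.
  apply/is_hermitianmxP; rewrite expr0 scale1r; apply/matrixP => i j.
  by rewrite !mxE conjR -[in LHS]Qs mxE.
have /orthomx_spectralP QE := hermitian_normalmx Qherm.
have dreal := hermitian_spectral_diag_real Qherm.
set P := spectralmx Qc in QE; set d := spectral_diag Qc in QE dreal.
have Pu : P \in unitmx := spectral_unit Qc.
have PtP : (map_mx Num.conj P^T) *m P = 1%:M.
  by rewrite -invmx_unitary ?spectral_unitarymx// mulVmx.
have PQ : P *m Qc = diag_mx d *m P by rewrite [in LHS]QE !mulmxA mulmxV// mul1mx.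
have dE i : d 0 i = real_complex R (complex.Re (d 0 i)).
  by rewrite RRe_real//; move/mxOverP: dreal; apply.
have normE (z : R[i]) : `|z| = real_complex R (complex.Re `|z|) by rewrite RRe_real ?normr_real.
exists (fun i => complex.Re (d 0 i)),
  (fun s i => complex.Re `|(P *m map_mx (real_complex R) s) i 0|); split.
(* Row [i] of [P] is a left eigenvector of [Qc], nonzero because [P] is invertible. The eigenvalue
   descends to the reals as a root of the characteristic polynomial. *)
- move=> i; suff: eigenvalue Qc (d 0 i).
    by rewrite dE !eigenvalue_root_char -map_char_poly fmorph_root.
  apply/eigenvalueP; exists (row i P).
    by rewrite -row_mul PQ row_mul row_diag_mx -scalemxAl -rowE.
  apply/negP => /eqP Pi0; have := mulmxV Pu => /(congr1 (row i)).
  rewrite row_mul Pi0 mul0mx => /rowP/(_ i).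
  by rewrite !mxE eqxx => /eqP; rewrite eq_sym oner_eq0.
- by move=> s i; rewrite -lecR -normE normr_ge0.
- move=> s; apply: (@complexI R); rewrite !rmorph_sum /=.
  set v := P *m _.
  transitivity ((map_mx Num.conj v^T *m v) 0 0).
    rewrite mxE; apply: eq_bigr => i _.
    by rewrite rmorphXn /= -normE normCK !mxE mulrC.
  rewrite /v trmx_mul map_mxM mulmxA -(mulmxA _ _ P) PtP mulmx1 mxE.
  apply: eq_bigr => i _.
  by rewrite !mxE rmorphXn /= conjR expr2.
(* Multiplying by [P] decouples the system: coordinatewise, w + (d_i + a) v = 0; then take
   moduli. *)
- move=> c s a /(congr1 (fun M => P *m map_mx (real_complex R) M)) E i.
  apply: (@complexI R); rewrite rmorphM /= -!normE.
  have -> : real_complex R `|complex.Re (d 0 i) + a| = `|d 0 i + real_complex R a|.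
    by rewrite [in RHS]dE -rmorphD /= normc_def /= expr0n addr0 sqrtr_sqr.
  move: E; rewrite !map_mxD map_mxM map_mxZ map_mx0 mulmx0 !mulmxDr mulmxA PQ.
  rewrite -mulmxA -scalemxAr => /colP /(_ i).
  move: (P *m map_mx _ s) (P *m map_mx _ c) => v w.
  rewrite mul_diag_mx !mxE => E; rewrite -normrM -[RHS]normrN; congr `|_|.
  by apply/eqP; rewrite -addr_eq0 -E; apply/eqP; ring.
Qed.

(** Turns a cardinality bound into counting in duplicate-free lists: an infinite [A] would contain a
    finite subset with [m.+1] elements. *)
Lemma card_le_uniq_size (T : choiceType) (A : set T) m :
  (forall s : seq T, uniq s -> (forall x, x \in s -> A x) -> (size s <= m)%N) ->
  A #<= `I_m.
Proof.
move=> H; have [Afin|Ainf] := pselect (finite_set A); last first.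
  have [B BA] := infinite_set_fset m.+1 Ainf.
  by rewrite leqNgt ltnS H//; apply: fset_uniq.
have /finite_fsetP[X AE] := Afin.
rewrite AE (card_le_eql (introT card_eq_fsetP (erefl _))) card_le_II.
by apply: H => [|x xX]; rewrite ?fset_uniq// AE.
Qed.

(** Strict convexity of t -> a / t on the positive reals, with unnormalized weights. Multiplied by
    (al + be) q, the gap equals al be a (r - p)^2 / (p r). *)
Lemma inv_strictly_convex (R : realFieldType) (p q r al be a u v w : R) :
  0 < al -> 0 < be -> 0 < p -> 0 < q -> 0 < r -> p != r -> 0 < a ->
  (al + be) * q = al * p + be * r -> p * u = a -> q * v = a -> r * w = a ->
  (al + be) * v < al * u + be * w.
Proof.
move=> al0 be0 p0 q0 r0 pr a0 qE uE vE wE.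
have abq : 0 < (al + be) * q by apply: mulr_gt0 => //; apply: addr_gt0.
rewrite -(ltr_pM2l abq) -subr_gt0.
have -> : (al + be) * q * (al * u + be * w) - (al + be) * q * ((al + be) * v)
  = al * be * a * ((r - p) ^+ 2 / (p * r)).
  have -> : u = a / p by rewrite -uE mulrC mulKf ?gt_eqF.
  have -> : w = a / r by rewrite -wE mulrC mulKf ?gt_eqF.
  rewrite [X in _ - X](_ : _ = (al + be) ^+ 2 * a); last by rewrite -vE; ring.
  by rewrite qE; field; rewrite !gt_eqF.
apply: mulr_gt0; first by rewrite !mulr_gt0.
apply: divr_gt0; last exact: mulr_gt0.
by rewrite exprn_even_gt0//= subr_eq0 eq_sym.
Qed.

(* Strict convexity in a squared form that sums over coordinates: by
   Cauchy-Schwarz, ((z - y) u + (y - x) w)^2 is bounded by the combination of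
   u^2 / x and w^2 / z on the right. *)
Lemma sqr_component_strictly_convex (R : realFieldType) (m x y z a u v w : R) :
  0 < x -> x < y -> y < z -> 0 < a -> 0 <= v ->
  `|m + x| * u = a -> `|m + y| * v = a -> `|m + z| * w = a ->
  ~~ (x < - m < z) ->
  (z - x) * (x * z) * v ^+ 2
    < y * ((z - y) * z * u ^+ 2 + (y - x) * x * w ^+ 2).
Proof.
move=> x0 xy yz a0 v0 uE vE wE npole.
have nz (t b : R) : `|t| * b = a -> t != 0.
  by move=> tE; apply: contraTneq a0 => t0; rewrite -tE t0 normr0 mul0r ltxx.
have mx0 := nz _ _ uE; have my0 := nz _ _ vE; have mz0 := nz _ _ wE.
(* With no pole strictly between [x] and [z], m + t keeps its sign on [x, z], so |m + t| is affine
   there and not constant. *)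
have absE : ((z - y) + (y - x)) * `|m + y|
              = (z - y) * `|m + x| + (y - x) * `|m + z| /\ `|m + x| != `|m + z|.
  move: npole; rewrite negb_and -!leNgt => /orP[h|h].
    rewrite !ger0_norm; first (by split; [ring|apply/eqP; lra]); lra.
  rewrite !ler0_norm; first (by split; [ring|apply/eqP; lra]); lra.
have [E ne] := absE.
have := @inv_strictly_convex R _ _ _ _ _ _ _ _ _ _ _ _ _ _ ne a0 E uE vE wE.
rewrite !subr_gt0 !normr_gt0 => /(_ yz xy mx0 my0 mz0).
have -> : z - y + (y - x) = z - x by ring.
move=> lin.
have zx : 0 < z - x by lra.
have lin0 : 0 <= (z - x) * v by apply: mulr_ge0 => //; lra.
have xz0 : 0 < x * z by apply: mulr_gt0 => //; lra.
have sq : ((z - x) * v) ^+ 2 < ((z - y) * u + (y - x) * w) ^+ 2.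
  by rewrite ltr_pXn2r// nnegrE// (le_trans lin0) ?ltW.
rewrite -(ltr_pM2l zx).
(* The Cauchy-Schwarz defect: as (z - y) x + (y - x) z = y (z - x), this term is (z - x) y ((z - y)
   z u^2 + (y - x) x w^2) - x z ((z - y) u + (y - x) w)^2. *)
have dE : 0 <= (z - y) * (y - x) * (x * w - z * u) ^+ 2.
  by apply: mulr_ge0; [apply: mulr_ge0; lra|exact: sqr_ge0].
have : (x * z) * ((z - x) * v) ^+ 2 < (x * z) * ((z - y) * u + (y - x) * w) ^+ 2.
  by rewrite ltr_pM2l.
by move=> h; lra.
Qed.

(** Induction on the sorted list: removing its two smallest elements uses up at least one separator,
    and at most two elements remain once the separators are exhausted. *)
Lemma size_le_separators (R : realDomainType) (s P : seq R) :
  uniq s ->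
  (forall x y z, x \in s -> y \in s -> z \in s -> x < y -> y < z ->
     exists2 p, p \in P & x < p < z) ->
  (size s <= 2 * (size P).+1)%N.
Proof.
rewrite -(sort_uniq <=%O) -(size_sort <=%O) => us H.
have {us} : sorted <%O (sort <=%O s) by rewrite lt_sorted_uniq_le us sort_le_sorted.
have {H} : forall x y z, x \in sort <=%O s -> y \in sort <=%O s ->
  z \in sort <=%O s -> x < y -> y < z -> exists2 p, p \in P & x < p < z.
  by move=> x y z; rewrite !mem_sort; apply: H.
move: (sort <=%O s) => {}s.
have [N] := ubnP (size s); elim: N s P => // N IHN [|x [|y [|z s]]] P //=;
  rewrite ?mulnS //.
rewrite ltnS => sN H /and3P[xy yz zs].
have [||||| p pP /andP[_ pz]] := H x y z; rewrite ?inE ?eqxx ?orbT//.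
(* Triples from [z] on only need separators above [z]; the separator [p] of [x], [y], [z] lies below
   [z] and drops out. *)
pose P' := [seq q <- P | z < q].
have lt_P' : (size P' < size P)%N.
  rewrite /P' size_filter -(count_predC (fun q => z < q) P) -addn1 leq_add2l.
  by rewrite -has_count; apply/hasP; exists p => //=; rewrite -leNgt ltW.
have := IHN (z :: s) P' => /(_ (ltnW sN)) /=.
have h : forall x0 y0 z0, x0 \in z :: s -> y0 \in z :: s -> z0 \in z :: s ->
  x0 < y0 -> y0 < z0 -> exists2 p0, p0 \in P' & x0 < p0 < z0.
  move=> x0 y0 z0 hx0 hy0 hz0 x0y0 y0z0.
  have sub t : t \in z :: s -> t \in [:: x, y, z & s].
    by move=> tin; rewrite inE [X in _ || X]inE tin !orbT.
  have [q qP /andP[x0q qz0]] :=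
    H _ _ _ (sub _ hx0) (sub _ hy0) (sub _ hz0) x0y0 y0z0.
  exists q; rewrite ?x0q//.
  rewrite mem_filter qP andbT (le_lt_trans _ x0q)//.
  move: hx0; rewrite inE => /predU1P[->//|]; move: zs; rewrite lt_path_sortedE.
  by case/andP => /allP + _ => /[apply] /ltW.
move=> /(_ h zs).
by move: (size P') (size P) (size s) lt_P' => a b c; clear; lia.
Qed.

(** Without a pole, the coordinatewise inequalities sum to a strict one, since their weights do not
    depend on [i]. Inserting the three norm equations makes both sides equal to x z y^2 (z - x), a
    contradiction. *)
Lemma secular_pole_between (R : realFieldType) (n : nat) (m a u v w : 'I_n -> R)
    (sigma x y z : R) :
  0 < sigma -> 0 <= x -> x < y -> y < z -> (forall i, 0 <= a i) ->
  (forall i, 0 <= v i) ->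
  (forall i, `|m i + x| * u i = a i) ->
  (forall i, `|m i + y| * v i = a i) ->
  (forall i, `|m i + z| * w i = a i) ->
  x ^+ 2 = sigma ^+ 2 * \sum_i u i ^+ 2 ->
  y ^+ 2 = sigma ^+ 2 * \sum_i v i ^+ 2 ->
  z ^+ 2 = sigma ^+ 2 * \sum_i w i ^+ 2 ->
  (forall i, a i = 0 -> m i + y != 0) ->
  exists2 i, a i != 0 & x < - m i < z.
Proof.
move=> s0 x0 xy yz a0 v0 uE vE wE xE yE zE hy.
have [/existsP[i /andP[ai pi]]|] := boolP [exists i, (a i != 0) && (x < - m i < z)].
  by exists i.
rewrite negb_exists => /forallP npole.
have v_eq0 i : a i = 0 -> v i = 0.
  move=> ai; have /eqP := vE i; rewrite ai mulf_eq0 normr_eq0.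
  by rewrite (negPf (hy i ai)) => /eqP.
have y0 : 0 < y by apply: le_lt_trans xy.
have [i0 ai0] : exists i, a i != 0.
  apply/existsP; apply: contraT; rewrite negb_exists => /forallP a_eq0.
  have sum0 : \sum_i v i ^+ 2 = 0.
    apply: big1 => i _; rewrite v_eq0 ?expr0n//.
    by apply/eqP; rewrite -[_ == _]negbK a_eq0.
  by move: yE; rewrite sum0 mulr0 => /eqP; rewrite sqrf_eq0 gt_eqF.
have s20 : 0 < sigma ^+ 2 by apply: exprn_gt0.
(* If [x] were 0, all [u i] would vanish, hence also [a i0]. *)
have {}x0 : 0 < x.
  rewrite lt_neqAle x0 andbT; apply: contraNneq ai0 => x_eq0.
  move: xE; rewrite -x_eq0 expr0n/= => /esym/eqP.
  rewrite mulf_eq0 gt_eqF//= psumr_eq0 => [|i _]; last exact: sqr_ge0.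
  by move/allP/(_ i0 (mem_index_enum _)); rewrite sqrf_eq0 -uE => /eqP->; rewrite mulr0.
have step i : a i != 0 -> (z - x) * (x * z) * v i ^+ 2
    < y * ((z - y) * z * u i ^+ 2 + (y - x) * x * w i ^+ 2).
  move=> ai; apply: (@sqr_component_strictly_convex _ (m i) _ _ _ (a i)) => //.
    by rewrite lt_neqAle eq_sym ai a0.
  by have := npole i; rewrite ai.
have le_step i : (z - x) * (x * z) * v i ^+ 2
    <= y * ((z - y) * z * u i ^+ 2 + (y - x) * x * w i ^+ 2).
  have [ai|/step/ltW//] := eqVneq (a i) 0.
  rewrite v_eq0// expr0n/= mulr0; apply: mulr_ge0; first exact: ltW.
  by apply: addr_ge0; apply: mulr_ge0 (sqr_ge0 _); apply: mulr_ge0; lra.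
have : (z - x) * (x * z) * (\sum_i v i ^+ 2)
    < y * ((z - y) * z * (\sum_i u i ^+ 2) + (y - x) * x * (\sum_i w i ^+ 2)).
  rewrite !mulr_sumr -big_split/= mulr_sumr [ltLHS](bigD1 i0)//= [ltRHS](bigD1 i0)//=.
  by apply: ltr_leD; [exact: step|apply: ler_sum].
rewrite -(ltr_pM2l s20) => h.
suff : x * z * y ^+ 2 * (z - x) < x * z * y ^+ 2 * (z - x) by rewrite ltxx.
rewrite [ltLHS](_ : _ = (z - x) * (x * z) * y ^+ 2); last by ring.
rewrite [ltRHS](_ : _ = y * ((z - y) * z * x ^+ 2 + (y - x) * x * z ^+ 2)); last by ring.
by rewrite xE yE zE; lra.
Qed.

Theorem proposition1 (R : realType) (n : nat) (c : 'cV[R]_n) (Q : 'M[R]_n)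
    (sigma : R) (k : nat)
    (Q_sym : Q^T = Q)
    (sigma_gt0 : 0 < sigma)
    (k_card : [set a : R | eigenvalue Q a /\ a < 0] #= `I_k) :
  [set lambda : R | exists s : 'cV[R]_n,
     c + Q *m s + lambda *: s = 0 /\ lambda = sigma * enorm s]
    #<= `I_(2 * k.+1).
Proof.
have [m [T [eig_m T_ge0 T_norm T_eq]]] := symmetric_spectral Q_sym.
have /finite_fsetP[X XE] : finite_set [set a : R | eigenvalue Q a /\ a < 0].
  by apply/finite_setP; exists k.
move: (k_card); rewrite XE => /card_eq_fsetP size_X.
pose N := [seq - a | a <- X : seq R].
have N_uniq : uniq N by rewrite map_inj_uniq ?fset_uniq//; apply: oppr_inj.
have size_N : size N = k by rewrite size_map.
have mem_N x : 0 < x -> eigenvalue Q (- x) -> x \in N.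
  move=> x0 ex; rewrite -[x]opprK map_f//.
  by suff : [set` X] (- x) by []; rewrite -XE /= oppr_lt0.
pose pole := [pred p | [exists i, (T c i != 0) && (p == - m i)]].
pose P := [seq p <- N | pole p].
have solP (l : R) : (exists s : 'cV[R]_n,
     c + Q *m s + l *: s = 0 /\ l = sigma * enorm s) ->
  0 <= l /\ exists u : 'I_n -> R, [/\ forall i, 0 <= u i,
    forall i, `|m i + l| * u i = T c i & l ^+ 2 = sigma ^+ 2 * \sum_i u i ^+ 2].
  move=> [s [sE lE]]; split; first by rewrite lE mulr_ge0 ?sqrtr_ge0 ?ltW.
  exists (T s); split=> // [i|]; first exact: T_eq.
  by rewrite lE T_norm exprMn sqr_sqrtr// sumr_ge0// => i _; rewrite sqr_ge0.
apply: card_le_uniq_size => s s_uniq sol.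
rewrite -(count_predC (mem N) s) -!size_filter.
(* A solution is never a pole: at l = - m_i the equation forces [T c i] to be 0. So the solutions in
   [N] are among the non-poles of [N]. *)
have le1 : (size [seq x <- s | mem N x] <= size [seq p <- N | predC pole p])%N.
  apply: uniq_leq_size; first exact: filter_uniq.
  move=> l; rewrite !mem_filter => /andP[/= lN /sol/solP[_ [u [_ uE _]]]].
  rewrite [l \in N]lN andbT; apply/existsPn => i; rewrite negb_and negbK orbC.
  by have [lE|//] := eqVneq l (- m i); rewrite -uE lE subrr normr0 mul0r eqxx.
(* Here the middle solution y > x >= 0 lies outside [N], so no m_i + y vanishes. The separating pole
   exceeds x >= 0, so it belongs to [N] and hence to [P]. *)
have le2 : (size [seq x <- s | predC (mem N) x] <= 2 * (size P).+1)%N.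
  apply: size_le_separators; first exact: filter_uniq.
  move=> x y z; rewrite !mem_filter /= => /andP[_ xs] /andP[yN ys] /andP[_ zs] xy yz.
  have [x0 [u [u0 uE xE]]] := solP x (sol x xs).
  have [y0 [v [v0 vE yE]]] := solP y (sol y ys).
  have [z0 [w [w0 wE zE]]] := solP z (sol z zs).
  have [i _|i ai /andP[xi iz]] := secular_pole_between sigma_gt0 x0 xy yz (T_ge0 c)
    v0 uE vE wE xE yE zE.
    apply: contra yN; rewrite addr_eq0 => /eqP miE; apply: mem_N; last by rewrite -miE.
    exact: le_lt_trans xy.
  exists (- m i); last by rewrite xi.
  rewrite mem_filter; apply/andP; split; first by apply/existsP; exists i; rewrite ai /=.
  by apply: mem_N; [exact: le_lt_trans xi|rewrite opprK].
have : (size P + size [seq p <- N | predC pole p] = k)%N.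
  by rewrite !size_filter count_predC.
move: le1 le2; move: (size _) (size _) (size _) (size _) => a b d e; lia.
Qed.
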